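(* For every odd integer $n\geq 1$ and any $t\in\{2,2n,n^2,2n^2\}$, there exists a pair of orthogonal cyclic $P_n$-decompositions of $K_{\frac{2n^2+t}{t}\times t}$.
   Context: $K_{q\times r}$ denotes the complete multipartite graph with $q$ parts each of size $r$. $P_k$ denotes the path of length $k$, i.e. with $k$ edges and $k+1$ distinct vertices. A $\Gamma$-decomposition of a graph $K$ is a set of subgraphs of $K$ (called blocks), all isomorphic to $\Gamma$, whose edge-sets partition the edge-set of $K$. A $\Gamma$-decomposition $\mathcal{D}$ of a graph $K$ on $v$ vertices is cyclic if, up to isomorphism, $V(K)=\mathbb{Z}_v$ and for every $B\in\mathcal{D}$ also $B+1\in\mathcal{D}$ (where $B+1$ is obtained by adding $1$ modulo $v$ to each vertex of $B$). Two decompositions $\mathcal{D}$ and $\mathcal{D}'$ of the same graph are orthogonal if $|E(B)\cap E(B')|\leq 1$ for all $B\in\mathcal{D}$ and $B'\in\mathcal{D}'$. *)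

(* Defs.v *)
From HB Require Import structures.
From mathcomp Require Import all_boot all_algebra.

Set Implicit Arguments.
Unset Strict Implicit.
Unset Printing Implicit Defensive.

Import GRing.Theory.

(* Finite simple graphs with vertices in T. The vertex set is a component, so
   that the subgraphs of a graph are again of type [graph T]. *)
Definition edges_ok (T : finType) (p : {set T} * {set {set T}}) : bool :=
  [forall e in p.2, (#|e| == 2) && (e \subset p.1)].

Record graph (T : finType) := Graph {
  graph_pair : {set T} * {set {set T}};
  graph_ok : edges_ok graph_pair
}.

HB.instance Definition _ (T : finType) := [isSub for @graph_pair T].
HB.instance Definition _ (T : finType) := [Finite of graph T by <:].

Definition vset (T : finType) (G : graph T) : {set T} := (graph_pair G).1.
Definition eset (T : finType) (G : graph T) : {set {set T}} := (graph_pair G).2.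

Definition subgraph (T : finType) (H G : graph T) : Prop :=
  vset H \subset vset G /\ eset H \subset eset G.

Definition isomorphic (T U : finType) (G : graph T) (H : graph U) : Prop :=
  exists f : T -> U,
    [/\ {in vset G &, injective f},
        f @: vset G = vset H
      & [set f @: (e : {set T}) | e in eset G] = eset H].

(* The image of a graph under an injective relabelling of the vertices. *)
Lemma image_graph_ok (T U : finType) (f : T -> U) (f_inj : injective f)
    (G : graph T) :
  edges_ok (f @: vset G, [set f @: (e : {set T}) | e in eset G]).
Proof.
apply/forall_inP => _ /imsetP[e eG ->]; rewrite /= card_imset //.
have /forall_inP/(_ e eG)/andP[-> eV] := graph_ok G.
by rewrite /= imsetS.
Qed.

Definition image_graph (T U : finType) (f : T -> U) (f_inj : injective f)
  (G : graph T) : graph U := Graph (image_graph_ok f_inj G).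

(* The path with k edges, on the k + 1 vertices 0, ..., k. *)
Definition path_edges (k : nat) : {set {set 'I_k.+1}} :=
  [set [set widen_ord (leqnSn k) i; lift ord0 i] | i : 'I_k].

Lemma path_graph_ok (k : nat) : edges_ok ([set: 'I_k.+1], path_edges k).
Proof.
apply/forall_inP => _ /imsetP[i _ ->]; rewrite subsetT andbT cards2.
by rewrite -val_eqE /= /bump /= add1n neq_ltn ltnSn.
Qed.

Definition path_graph (k : nat) : graph 'I_k.+1 := Graph (path_graph_ok k).

(* K_{q x r}: the vertex (i, j) is the j-th vertex of the i-th part. *)
Definition multipartite_edges (q r : nat) : {set {set 'I_q * 'I_r}} :=
  [set [set x; y] | x in [set: 'I_q * 'I_r],
                    y in [set y : 'I_q * 'I_r | x.1 != y.1]].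

Lemma complete_multipartite_ok (q r : nat) :
  edges_ok ([set: 'I_q * 'I_r], multipartite_edges q r).
Proof.
apply/forall_inP => _ /imset2P[x y _ + ->]; rewrite inE subsetT andbT cards2.
by case: (x =P y) => [->|//]; rewrite eqxx.
Qed.

Definition complete_multipartite (q r : nat) : graph ('I_q * 'I_r)%type :=
  Graph (complete_multipartite_ok q r).

(* [partition] speaks of the set of edge-sets, hence the separate requirement
   that different blocks have different edge-sets. *)
Definition decomposition (S T : finType) (Gamma : graph S) (K : graph T)
    (D : {set graph T}) : Prop :=
  [/\ forall B, B \in D -> subgraph B K /\ isomorphic B Gamma,
      {in D &, injective (@eset T)}
    & partition [set eset B | B in D] (eset K)].

(* B + 1. Note that 'Z_v is Z/vZ only for v >= 2. *)
Definition translate (v : nat) (B : graph 'Z_v) : graph 'Z_v :=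
  image_graph (addIr (1%R : 'Z_v)) B.

Definition cyclic_decomposition (v : nat) (S : finType) (Gamma : graph S)
    (K : graph 'Z_v) (D : {set graph 'Z_v}) : Prop :=
  [/\ decomposition Gamma K D,
      vset K = [set: 'Z_v]
    & forall B, B \in D -> translate B \in D].

Definition orthogonal_decompositions (T : finType) (D D' : {set graph T}) : Prop :=
  forall B B', B \in D -> B' \in D' -> #|eset B :&: eset B'| <= 1.

(* Main.v *)
(** Let [v = 2 * n ^ 2 + t] and [m = v / t]. The complete multipartite graph
    joins [x] and [y] in [Z_v] when [m] does not divide [x - y], so each edge is
    [{x, x + d}] for a unique [x] and a unique [d < v / 2] not divisible by [m].
    There are [n ^ 2] such differences [d], and they are placed in increasing
    order, row after row, in an [n] by [n] array, so that rows and columns both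
    increase. The walk from [0] with steps [+ b_0, - b_1, + b_2, ...] along an
    increasing row or column [b] never repeats a vertex. The translates of the
    [n] row paths form one decomposition and those of the [n] column paths the
    other. A row and a column have only one difference in common, whence
    orthogonality. *)
Require Import Defs.
From mathcomp Require Import all_boot all_algebra.
From mathcomp Require Import zify ring.

Set Implicit Arguments.
Unset Strict Implicit.
Unset Printing Implicit Defensive.

Import GRing.Theory.

Local Open Scope ring_scope.

(** * Relabelled graphs *)

Lemma isomorphic_image_graph (T U : finType) (x0 : T) (f : T -> U)
    (f_inj : injective f) (G : graph T) :
  isomorphic (image_graph f_inj G) G.
Proof.
(* A total left inverse of [f]; [x0] is its value off the image. *)
pose g y := odflt x0 [pick x | f x == y].
have fK : cancel f g.
  by rewrite /g => x; case: pickP => [y /eqP/f_inj //|/(_ x)]; rewrite eqxx.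
exists g; split.
- by move=> _ _ /imsetP[x _ ->] /imsetP[y _ ->]; rewrite !fK => ->.
- by rewrite /vset /= -imset_comp (eq_imset (g := id)) ?imset_id.
- rewrite /eset /= -imset_comp (eq_imset (g := id)) ?imset_id // => e /=.
  by rewrite -imset_comp (eq_imset (g := id)) ?imset_id.
Qed.

Lemma eq_image_graph (T U : finType) (f g : T -> U) (f_inj : injective f)
    (g_inj : injective g) (G : graph T) :
  f =1 g -> image_graph f_inj G = image_graph g_inj G.
Proof.
move=> fg; apply: val_inj; rewrite /= (eq_imset _ fg); congr pair.
by apply: eq_imset => e; apply: eq_imset.
Qed.

Lemma image_graph_comp (T U W : finType) (f : T -> U) (h : U -> W)
    (f_inj : injective f) (h_inj : injective h) (G : graph T) :
  image_graph h_inj (image_graph f_inj G) =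
  image_graph (inj_comp h_inj f_inj) G.
Proof.
apply: val_inj; rewrite /= /vset /eset /= -!imset_comp; congr pair.
by apply: eq_imset => e /=; rewrite -imset_comp.
Qed.

(** * Arcs of a given difference in ['Z_v] *)

Lemma Zp_nat_neq0 (v k : nat) : (0 < k < v)%N -> k%:R != 0 :> 'Z_v.
Proof.
move=> /andP[k0 kv]; rewrite -val_eqE /= val_Zp_nat ?modn_small ?lt0n_neq0 //.
exact: leq_ltn_trans kv.
Qed.

Definition arc (v : nat) (x : 'Z_v) (d : nat) : {set 'Z_v} := [set x; x + d%:R].

(** If the endpoints matched crosswise, [d + e] would vanish modulo [v], although it lies strictly
    between 0 and [v]. *)
Lemma arc_inj (v : nat) (x y : 'Z_v) (d e : nat) :
  (0 < d)%N -> (2 * d < v)%N -> (0 < e)%N -> (2 * e < v)%N ->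
  arc x d = arc y e -> x = y /\ d = e.
Proof.
move=> d0 dv e0 ev xy.
have d_neq0 : d%:R != 0 :> 'Z_v by apply: Zp_nat_neq0; lia.
have e_neq0 : e%:R != 0 :> 'Z_v by apply: Zp_nat_neq0; lia.
have de_neq0 : (d + e)%:R != 0 :> 'Z_v by apply: Zp_nat_neq0; lia.
have : x \in arc y e by rewrite -xy set21.
case/set2P => Ex.
- have : x + d%:R \in arc y e by rewrite -xy set22.
  rewrite Ex; case/set2P => [/(canRL (addKr _))|/addrI/(congr1 val)].
    by rewrite addNr => Ed; rewrite Ed eqxx in d_neq0.
  by rewrite /= !val_Zp_nat ?modn_small //; lia.
- have : y \in arc x d by rewrite xy set21.
  case/set2P; rewrite Ex -?addrA => /esym/(canRL (addKr _)); rewrite addNr.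
    by move=> Ee; rewrite Ee eqxx in e_neq0.
  by rewrite -natrD addnC => Ede; rewrite Ede eqxx in de_neq0.
Qed.

(** * Alternating walks *)

Definition zigzag (v : nat) (b : nat -> nat) (k : nat) : 'Z_v :=
  \sum_(j < k) (-1) ^+ j * (b j)%:R.

Lemma zigzagS (v : nat) (b : nat -> nat) (k : nat) :
  zigzag v b k.+1 = zigzag v b k + (-1) ^+ k * (b k)%:R.
Proof. exact: big_ord_recr. Qed.

(* The last step of a stretch of the walk exceeds what the earlier steps of the
   stretch add up to, so the stretch has the sign of its last step. *)
Lemma zigzag_sub (v : nat) (b : nat -> nat) (i d : nat) :
  (forall k, (0 < b k < b k.+1)%N) ->
  exists2 r : nat, (0 < r <= b (i + d))%N &
    zigzag v b (i + d).+1 - zigzag v b i = (-1) ^+ (i + d) * r%:R.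
Proof.
move=> b_incr; elim: d => [|d [r r_bnd Er]].
  exists (b i); first by rewrite addn0 leqnn; case/andP: (b_incr i) => ->.
  by rewrite addn0 zigzagS addrC addKr.
have := b_incr (i + d)%N; rewrite addnS => b_d.
exists (b (i + d).+1 - r)%N; first by lia.
rewrite zigzagS addrAC Er natrB; last by lia.
by rewrite exprS; ring.
Qed.

(** Odd steps go backwards, so the arc of such an edge starts at the later of its two vertices. *)
Definition zigzag_end (v : nat) (b : nat -> nat) (k : nat) : 'Z_v :=
  zigzag v b (if odd k then k.+1 else k).

Lemma zigzag_edge (v : nat) (b : nat -> nat) (g : 'Z_v) (k : nat) :
  [set zigzag v b k + g; zigzag v b k.+1 + g] = arc (zigzag_end v b k + g) (b k).
Proof.
rewrite /arc /zigzag_end; case: ifP => k_odd; rewrite zigzagS -signr_odd k_odd.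
  by rewrite setUC; congr [set _; _]; rewrite expr1; ring.
by rewrite expr0 mul1r addrAC.
Qed.

(* The rows of an array of steps, indexed by [I] and of length [n]. Each row is
   extended beyond [n] so that monotonicity needs no bound. *)
Definition step_array (v n : nat) (I : finType) (b : I -> nat -> nat) : Prop :=
  [/\ forall i k, (0 < b i k < b i k.+1)%N,
      forall i k, (k < n)%N -> (2 * b i k < v)%N
    & forall i j k l, (k < n)%N -> (l < n)%N -> b i k = b j l -> i = j /\ k = l].

Definition walk (v n : nat) (I : finType) (b : I -> nat -> nat)
    (i : I) (g : 'Z_v) (k : 'I_n.+1) : 'Z_v := zigzag v (b i) k + g.

Lemma walk_inj (v n : nat) (I : finType) (b : I -> nat -> nat) i g :
  step_array v n b -> injective (@walk v n I b i g).
Proof.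
move=> [b_incr b_lt _] k l /addIr E; apply: val_inj => /=.
wlog: k l E / (k < l)%N => [H|kl].
  by case: (ltngtP k l) => [|lk|//]; [|apply/esym]; apply: H.
(* The stretch from [k] to [l] has last step [l.-1], so its net length is at most [b i l.-1 < v / 2]
   and cannot vanish modulo [v]. *)
have [r] := zigzag_sub v k (l - k.+1) (b_incr i).
have -> : (k + (l - k.+1)).+1 = l by lia.
have -> : (k + (l - k.+1))%N = l.-1 by lia.
have /(b_lt i) bl : (l.-1 < n)%N by have := ltn_ord l; lia.
move=> r_bnd; rewrite -E subrr => /esym/eqP.
by rewrite mulrI_eq0 ?(negPf (Zp_nat_neq0 _)) //; [lia | exact: lreg_sign].
Qed.

(** * Decompositions into translates of walks *)

Definition block (v n : nat) (I : finType) (b : I -> nat -> nat)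
    (b_ok : step_array v n b) (i : I) (g : 'Z_v) : graph 'Z_v :=
  image_graph (walk_inj (i := i) (g := g) b_ok) (path_graph n).

Definition blocks (v n : nat) (I : finType) (b : I -> nat -> nat)
    (b_ok : step_array v n b) : {set graph 'Z_v} :=
  [set block b_ok p.1 p.2 | p : I * 'Z_v].

Lemma eset_blockP (v n : nat) (I : finType) (b : I -> nat -> nat)
    (b_ok : step_array v n b) i g (e : {set 'Z_v}) :
  reflect (exists2 k, (k < n)%N & e = arc (zigzag_end v (b i) k + g) (b i k))
          (e \in eset (block b_ok i g)).
Proof.
apply: (iffP imsetP) => [[_ /imsetP[k _ ->] ->]|[k kn ->]].
  by exists k; rewrite // -zigzag_edge imsetU1 imset_set1.
exists [set widen_ord (leqnSn n) (Ordinal kn); lift ord0 (Ordinal kn)].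
  exact: imset_f.
by rewrite -zigzag_edge imsetU1 imset_set1.
Qed.

(** An edge determines its start and its difference, the difference its place in the array, and the
    place and start together the translation; so each edge lies in exactly one block. *)
Lemma zigzag_decomposition (v n : nat) (I : finType) (b : I -> nat -> nat)
    (b_ok : step_array v n b) (K : graph 'Z_v) :
  (0 < n)%N -> vset K = [set: 'Z_v] ->
  (forall e, e \in eset K <-> exists x i k, (k < n)%N /\ e = arc x (b i k)) ->
  cyclic_decomposition (path_graph n) K (blocks b_ok).
Proof.
move=> n_gt0 VK EK; have [b_incr b_lt b_inj] := b_ok.
have block_edge i g e : e \in eset (block b_ok i g) -> e \in eset K.
  case/eset_blockP=> k kn ->; apply/EK.
  by exists (zigzag_end v (b i) k + g), i, k.
(* This gives disjointness and, as every block has an edge, also the injectivity of [eset] on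
   blocks. *)
have meet i j g h e : e \in eset (block b_ok i g) ->
    e \in eset (block b_ok j h) -> block b_ok i g = block b_ok j h.
  case/eset_blockP=> k kn -> /eset_blockP[l ln].
  case/arc_inj; rewrite ?b_lt //.
  - by case/andP: (b_incr i k).
  - by case/andP: (b_incr j l).
  by move=> + /b_inj[] // ij kl; rewrite ij kl => /addrI ->.
have edge0 i g : exists e, e \in eset (block b_ok i g).
  by eexists; apply/eset_blockP; exists 0%N.
split=> //; last first.
  move=> _ /imsetP[[i g] _ ->]; apply/imsetP; exists (i, g + 1) => //.
  rewrite /translate /block image_graph_comp.
  by apply: eq_image_graph => k /=; rewrite /walk addrA.
split.
- move=> _ /imsetP[[i g] _ ->]; split; last exact: (isomorphic_image_graph ord0).
  by split; [rewrite VK subsetT | apply/subsetP => e /block_edge].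
- move=> _ _ /imsetP[[i g] _ ->] /imsetP[[j h] _ ->] /= E.
  by have [e e_in] := edge0 i g; apply: (meet _ _ _ _ e); rewrite // -E.
apply/and3P; split.
- apply/eqP/setP => e; apply/bigcupP/idP.
    by case=> _ /imsetP[_ /imsetP[[i g] _ ->] ->] /block_edge.
  case/EK => x [i [k [kn ->]]]; pose g := x - zigzag_end v (b i) k.
  exists (eset (block b_ok i g)); first by apply/imset_f/imsetP; exists (i, g).
  by apply/eset_blockP; exists k; rewrite // addrC subrK.
- apply/trivIsetP => _ _ /imsetP[_ /imsetP[[i g] _ ->] ->]
    /imsetP[_ /imsetP[[j h] _ ->] ->] /=; apply: contraR.
  by rewrite -setI_eq0 => /set0Pn[e /setIP[ei /(meet _ _ _ _ _ ei) ->]].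
- apply/imsetP => -[_ /imsetP[[i g] _ ->]] /= E.
  by have [e] := edge0 i g; rewrite -E inE.
Qed.

(** By [arc_inj] a common edge has the same difference in both blocks, and in the first block its
    position determines the edge. Hence one common position allows only one common edge, whatever
    the translations. *)
Lemma zigzag_orthogonal (v n : nat) (I J : finType) (b : I -> nat -> nat)
    (c : J -> nat -> nat) (b_ok : step_array v n b) (c_ok : step_array v n c) :
  (forall i j k k' l l',
     (k < n)%N -> (k' < n)%N -> (l < n)%N -> (l' < n)%N ->
     b i k = c j l -> b i k' = c j l' -> k = k') ->
  orthogonal_decompositions (blocks b_ok) (blocks c_ok).
Proof.
move=> bc _ _ /imsetP[[i g] _ ->] /imsetP[[j h] _ ->] /=.
have common e : e \in eset (block b_ok i g) :&: eset (block c_ok j h) ->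
    exists k l, [/\ (k < n)%N, (l < n)%N, b i k = c j l
                  & e = arc (zigzag_end v (b i) k + g) (b i k)].
  have [b_incr b_lt _] := b_ok; have [c_incr c_lt _] := c_ok.
  case/setIP => /eset_blockP[k kn ->] /eset_blockP[l ln E].
  exists k, l; split=> //; case: (arc_inj _ _ _ _ E); rewrite ?b_lt ?c_lt //.
  - by case/andP: (b_incr i k).
  - by case/andP: (c_incr j l).
apply/card_le1_eqP => e f /common[k [l [kn ln E ->]]].
move=> /common[k' [l' [kn' ln' E' ->]]].
by rewrite (bc _ _ _ _ _ _ kn kn' ln ln' E E').
Qed.

(** * The differences that occur *)

(* The increasing enumeration, from [0], of the positive integers that [w.+1]
   does not divide. *)
Definition nondiv (w k : nat) : nat := (k + k %/ w).+1.

Lemma nondiv_lt (w j k : nat) : (j < k)%N -> (nondiv w j < nondiv w k)%N.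
Proof. by move=> jk; have := leq_div2r w (ltnW jk); rewrite /nondiv; lia. Qed.

Lemma nondiv_inj (w : nat) : injective (nondiv w).
Proof.
by move=> j k E; case: (ltngtP j k) => // /(nondiv_lt w); rewrite E ltnn.
Qed.

Lemma nondivP (w d : nat) : (0 < w)%N ->
  reflect (exists k, d = nondiv w k) ((0 < d)%N && ~~ (w.+1 %| d)%N).
Proof.
move=> w0; apply: (iffP andP) => [[d0 dvd]|[k ->]].
  (* The index of [d] counts the positive integers below [d], less the multiples of [w.+1] among
     them. *)
  exists (d.-1 - d %/ w.+1)%N; move: dvd; rewrite /dvdn /nondiv.
  have := ltn_pmod d (ltn0Sn w); have := divn_eq d w.+1.
  set q := (d %/ _)%N; set r := (d %% _)%N => E r_lt r0.
  have -> : (d.-1 - q = q * w + r.-1)%N by nia.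
  by rewrite divnMDl // divn_small; lia.
split; rewrite // /nondiv {1}(divn_eq k w).
have -> : ((k %/ w * w + k %% w + k %/ w).+1 = k %/ w * w.+1 + (k %% w).+1)%N.
  by lia.
by rewrite dvdn_addr ?dvdn_mull // gtnNdvd // ltnS ltn_pmod.
Qed.

(** Put [v = 2 * N + t = w.+1 * t]. Between 0 and [v] there are [2 * N] non-multiples of [w.+1];
    exchanging [d] with [v - d] pairs them, so [N] lie below [v / 2]. *)
Lemma nondiv_double_lt (w t N k : nat) :
  (0 < w)%N -> (w * t = 2 * N)%N -> (2 * nondiv w k < 2 * N + t)%N = (k < N)%N.
Proof.
move=> w0 wtN; rewrite /nondiv.
have := ltn_pmod k w0; have := divn_eq k w.
set q := (k %/ w)%N; set r := (k %% w)%N => -> r_lt.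
apply/idP/idP => H; nia.
Qed.

(** * The complete multipartite graph on ['Z_v], its parts being the residue classes modulo [q] *)

Lemma multipartite_embedding_inj (v q r : nat) (v_gt1 : (1 < v)%N)
    (v_qr : v = (q * r)%N) :
  injective (fun x : 'I_q * 'I_r => (x.1 + x.2 * q)%:R : 'Z_v).
Proof.
move=> [i j] [i' j'] /= /(congr1 val); rewrite /= !val_Zp_nat //.
have lt_v (a : 'I_q) (c : 'I_r) : (a + c * q < v)%N.
  by have := ltn_ord a; have := ltn_ord c; nia.
rewrite !modn_small // => E; have := ltn_ord i; have := ltn_ord i' => i'q iq.
congr pair; apply: val_inj => /=.
  by have := congr1 (modn^~ q) E; rewrite !(addnC _ (_ * q)%N) !modnMDl !modn_small.
by have := congr1 (divn^~ q) E; rewrite !divnDMl ?divn_small //; lia.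
Qed.

Definition cyclic_multipartite (v q r : nat) (v_gt1 : (1 < v)%N)
    (v_qr : v = (q * r)%N) : graph 'Z_v :=
  image_graph (multipartite_embedding_inj v_gt1 v_qr) (complete_multipartite q r).

Section CyclicMultipartite.

Variables (v q r : nat) (v_gt1 : (1 < v)%N) (v_qr : v = (q * r)%N).

Let emb (x : 'I_q * 'I_r) : 'Z_v := (x.1 + x.2 * q)%:R.

Let q_gt0 : (0 < q)%N.
Proof. by rewrite lt0n; apply/eqP => q0; move: v_gt1; rewrite v_qr q0. Qed.

Let q_dvd_v : (q %| v)%N.
Proof. by rewrite v_qr dvdn_mulr. Qed.

Let emb_mod x : (emb x %% q)%N = x.1.
Proof.
rewrite /emb val_Zp_nat // modn_dvdm //.
by rewrite addnC modnMDl modn_small.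
Qed.

Let emb_surj (x : 'Z_v) : exists y, emb y = x.
Proof.
have x_lt : (x < v)%N by rewrite -[X in (_ < X)%N](Zp_cast v_gt1).
have x_mod : (x %% q < q)%N by rewrite ltn_pmod.
have x_div : (x %/ q < r)%N by rewrite ltn_divLR // mulnC -v_qr.
exists (Ordinal x_mod, Ordinal x_div).
by rewrite /emb /= addnC -divn_eq natr_Zp.
Qed.

Lemma vset_cyclic_multipartite : vset (cyclic_multipartite v_gt1 v_qr) = [set: 'Z_v].
Proof.
apply/setP => x; rewrite in_setT; have [y <-] := emb_surj x.
exact: imset_f.
Qed.

Lemma eset_cyclic_multipartiteP (e : {set 'Z_v}) :
  reflect (exists x y : 'Z_v, (x %% q != y %% q)%N /\ e = [set x; y])
          (e \in eset (cyclic_multipartite v_gt1 v_qr)).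
Proof.
apply: (iffP imsetP) => [[_ /imset2P[x y _ xy ->] ->]|[x [y [xy ->]]]].
  exists (emb x), (emb y); rewrite !emb_mod imsetU1 imset_set1; split=> //.
  by move: xy; rewrite inE.
have [x' Ex] := emb_surj x; have [y' Ey] := emb_surj y.
exists [set x'; y']; last by rewrite imsetU1 imset_set1 -Ex -Ey.
by apply: imset2_f; rewrite ?inE // -val_eqE /= -!emb_mod Ex Ey.
Qed.

(* When [v] is even, the difference [v / 2] must be a multiple of [q], lest it
   give an arc that is counted from both of its ends. *)
Lemma eset_cyclic_multipartite_arc (e : {set 'Z_v}) :
  (forall d, (2 * d = v)%N -> (q %| d)%N) ->
  e \in eset (cyclic_multipartite v_gt1 v_qr) <->
  exists x d, [/\ (0 < d)%N, (2 * d < v)%N, ~~ (q %| d)%N & e = arc x d].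
Proof.
move=> half; split=> [/eset_cyclic_multipartiteP[x [y []]]|[x [d [d0 dv qd ->]]]].
  have lt_v (z : 'Z_v) : (z < v)%N by rewrite -[X in (_ < X)%N](Zp_cast v_gt1).
  wlog yx : x y / (y < x)%N => [H|xy ->].
    case: (ltngtP x y) => [xy|yx|->]; last by rewrite eqxx.
      by rewrite eq_sym setUC => *; exact: H xy _ _.
    by move=> *; exact: H yx _ _.
  have qd : ~~ (q %| x - y)%N by rewrite -eqn_mod_dvd // ltnW.
  case: (ltngtP (2 * (x - y)) v) => [dv|dv|/half]; last by rewrite (negPf qd).
    exists y, (x - y)%N; split=> //; first by rewrite subn_gt0.
    by rewrite /arc natrB ?(ltnW yx) // !natr_Zp addrC subrK setUC.
  (* The long way round is replaced by the short one, from [x] past 0 to [y]; [q] divides [v], so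
     non-divisibility survives. *)
  exists x, (v - (x - y))%N; have := lt_v x => xv; split; [lia|lia| |].
    by rewrite dvdn_subr //; lia.
  rewrite /arc natrB; last by lia.
  have -> : v%:R = 0 :> 'Z_v by exact: pchar_Zp.
  by rewrite sub0r natrB ?(ltnW yx) // !natr_Zp opprB addrC subrK.
apply/eset_cyclic_multipartiteP; exists x, (x + d%:R); split=> //.
rewrite -[x in (x + _)%R]natr_Zp -natrD val_Zp_nat // modn_dvdm //.
by rewrite eq_sym -[X in _ == (X %% q)%N]addn0 eqn_modDl mod0n.
Qed.

End CyclicMultipartite.

(** * The square array of differences *)

Lemma multipartite_orthogonal_decompositions (n t : nat) :
  (0 < n)%N -> (t %| 2 * n ^ 2)%N ->
  exists K : graph 'Z_(2 * n ^ 2 + t),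
    isomorphic K (complete_multipartite ((2 * n ^ 2 + t) %/ t) t) /\
    exists D D' : {set graph 'Z_(2 * n ^ 2 + t)},
      [/\ cyclic_decomposition (path_graph n) K D,
          cyclic_decomposition (path_graph n) K D'
        & orthogonal_decompositions D D'].
Proof.
move=> n0 t_dvd; set v := (2 * n ^ 2 + t)%N.
have N0 : (0 < n ^ 2)%N by rewrite expn_gt0 n0.
have t0 : (0 < t)%N by apply: dvdn_gt0 t_dvd; lia.
pose w := (2 * n ^ 2 %/ t)%N.
have wt : (w * t = 2 * n ^ 2)%N by rewrite divnK.
have w0 : (0 < w)%N by nia.
have q_w : (v %/ t)%N = w.+1 by rewrite /v divnDr // divnn t0 addn1.
have v1 : (1 < v)%N by lia.
have v_qt : v = ((v %/ t) * t)%N by rewrite q_w /v -wt; lia.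
(* If [v] is even then so is [t]: for odd [t], both [w] and [w.+1] would be even. Hence [v / 2] is
   [t./2] times [w.+1]. *)
have half d : (2 * d = v)%N -> (v %/ t %| d)%N.
  rewrite q_w => dv; have dw : (2 * d = w.+1 * t)%N by rewrite dv /v -wt; lia.
  have : ~~ odd (w.+1 * t) by rewrite -dw mul2n odd_double.
  have : ~~ odd (w * t) by rewrite wt mul2n odd_double.
  rewrite !oddM /=; case t_odd: (odd t) => /=; first by rewrite !andbT => /negPf->.
  move=> _ _; apply/dvdnP; exists t./2.
  have := odd_double_half t; rewrite t_odd; nia.
pose K := cyclic_multipartite v1 v_qt.
have EK e : e \in eset K <-> exists x j, (j < n ^ 2)%N /\ e = arc x (nondiv w j).
  split=> [/(eset_cyclic_multipartite_arc v1 v_qt _ half)|[x [j [jN ->]]]].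
    rewrite q_w => -[x [d [d0 dv qd ->]]].
    have /(nondivP _ w0)[j dj] : (0 < d)%N && ~~ (w.+1 %| d)%N by rewrite d0.
    by exists x, j; rewrite -(nondiv_double_lt _ w0 wt) -dj.
  apply/(eset_cyclic_multipartite_arc v1 v_qt _ half); exists x, (nondiv w j).
  rewrite q_w nondiv_double_lt // jN; split=> //.
  by have /andP[] : (0 < nondiv w j)%N && ~~ (w.+1 %| nondiv w j)%N
    by apply/nondivP => //; exists j.
(* Past its end a row runs on into the next row, and a column into further rows below; both keep
   increasing. *)
pose row (i : 'I_n) k := nondiv w (n * i + k).
pose col (i : 'I_n) k := nondiv w (n * k + i).
have cell_lt i k : (i < n)%N -> (k < n)%N -> (n * i + k < n ^ 2)%N by nia.
have cell_inj i j k l : (k < n)%N -> (l < n)%N -> (n * i + k = n * j + l)%N ->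
    i = j /\ k = l.
  move=> kn ln E; suff: i = j by lia.
  by have := congr1 (divn^~ n) E; rewrite !(mulnC n) !divnMDl // !divn_small ?addn0.
have row_ok : step_array v n row.
  split=> [i k|i k kn|i j k l kn ln /nondiv_inj/cell_inj[] // /val_inj] //.
  - by rewrite nondiv_lt //; lia.
  - by rewrite nondiv_double_lt // cell_lt.
have col_ok : step_array v n col.
  split=> [i k|i k kn|i j k l kn ln /nondiv_inj/cell_inj[] // -> /val_inj] //.
  - by rewrite nondiv_lt //; lia.
  - by rewrite nondiv_double_lt // cell_lt.
exists K; split.
  have q0 : (0 < v %/ t)%N by rewrite q_w.
  exact: (isomorphic_image_graph (Ordinal q0, Ordinal t0)).
exists (blocks row_ok), (blocks col_ok).
(* Quotient and remainder by [n] are the row and column of the [j]-th difference. *)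
have n_split j : (j < n ^ 2)%N -> (j %/ n < n)%N /\ (j %% n < n)%N.
  by move=> jN; rewrite ltn_divLR // ltn_pmod.
split.
- apply: zigzag_decomposition => //; first exact: vset_cyclic_multipartite.
  move=> e; split=> [/EK[x [j [/n_split[jd jm] ->]]]|[x [i [k [kn ->]]]]].
    by exists x, (Ordinal jd), (j %% n)%N; rewrite /row mulnC -divn_eq.
  by apply/EK; exists x, (n * i + k)%N; rewrite cell_lt.
- apply: zigzag_decomposition => //; first exact: vset_cyclic_multipartite.
  move=> e; split=> [/EK[x [j [/n_split[jd jm] ->]]]|[x [i [k [kn ->]]]]].
    by exists x, (Ordinal jm), (j %/ n)%N; rewrite /col /= mulnC -divn_eq.
  by apply/EK; exists x, (n * k + i)%N; rewrite cell_lt.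
(* A cell shared by row [i] and column [j] is at position [j] of the row, so [k] and [k'] both equal
   [j]. *)
- apply: zigzag_orthogonal => i j k k' l l' kn kn' ln ln'.
  move=> /nondiv_inj/cell_inj[] // _ -> /nondiv_inj/cell_inj[] // _ ->.
Qed.

Local Open Scope nat_scope.

Theorem proposition4p3 (n t : nat) (n_ge1 : 1 <= n) (n_odd : odd n)
    (t_in : t \in [:: 2; 2 * n; n ^ 2; 2 * n ^ 2]) :
  exists K : graph 'Z_(2 * n ^ 2 + t),
    isomorphic K (complete_multipartite ((2 * n ^ 2 + t) %/ t) t) /\
    exists D D' : {set graph 'Z_(2 * n ^ 2 + t)},
      [/\ cyclic_decomposition (path_graph n) K D,
          cyclic_decomposition (path_graph n) K D'
        & orthogonal_decompositions D D'].
Proof.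
apply: multipartite_orthogonal_decompositions => //.
move: t_in; rewrite !inE => /or4P[] /eqP->.
- exact: dvdn_mulr.
- by rewrite dvdn_mul // dvdn_exp.
- exact: dvdn_mull.
- exact: dvdnn.
Qed.
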